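(* Let $n\ge2$, let $r=|x|$ for $x\in\mathbb{R}^n$, and let $u=u(r)$ be the function whose graph is the bowl-type solution for the speed function $f=\sqrt[n]{S_n}$, where $S_n(\lambda)=\lambda_1\cdots\lambda_n$. Then, as $r\to\infty$, $$u(r)=\begin{cases}\displaystyle\int_0^r e^{\frac{s^2}{2}}\,ds+O\left(\int_0^r\sqrt{e^{\frac{s^2}{2}}-1}\,ds\right),& n=2,\\[2mm] \dfrac{r^4}{12}+O(r),& n=3,\\[2mm] \dfrac{(n-2)^{\frac{n-1}{n-2}}}{2(n-1)\,n^{\frac{1}{n-2}}}\,r^{\frac{2(n-1)}{n-2}}+O\left(r^{\frac{2}{n-2}}\right),& n\ge4.\end{cases}$$
   Context: The speed $f=\sqrt[n]{S_n}$ is defined on $\Gamma_+=\{\lambda\in\mathbb{R}^n:\lambda_i>0\}$. A graph $\{(x,u(x))\}\subset\mathbb{R}^{n+1}$ is an $f$-translator if $f(\lambda)=\frac1{\sqrt{1+|Du|^2}}$, where $\lambda$ are the principal curvatures of the graph, with sign such that they are nonnegative when $u$ is convex. For $u=u(r)$, $r=|x|$, one has $\lambda_1=\frac{u''}{(1+u'^2)^{3/2}}$ and $\lambda_i=\frac{u'}{r\sqrt{1+u'^2}}$ for $i\ge2$. The bowl-type solution is the complete, strictly convex, rotationally symmetric graphical $f$-translator (unique up to vertical translation). Its slope $v=u'$ is the solution of $v'=(1+v^2)\left(\frac{r}{v}\right)^{n-1}$ for $r>0$ with $v(0)=0$. *)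

(* Defs.v *)
From HB Require Import structures.
From mathcomp Require Import all_boot all_order all_algebra.
From mathcomp Require Import all_classical all_reals all_analysis.

Set Implicit Arguments.
Unset Strict Implicit.
Unset Printing Implicit Defensive.

Import Order.TTheory GRing.Theory Num.Theory.
Import numFieldNormedType.Exports.

Local Open Scope classical_set_scope.
Local Open Scope ring_scope.

(* Landau notations at +oo need a canonical bundled filter. *)
Canonical pinfty_filter_on (R : numFieldType) : filter_on R :=
  FilterType (pinfty_nbhs R) _.

(* The library norm on 'rV[R]_n is the sup norm, hence a separate name. *)
Definition enorm (R : realType) (n : nat) (x : 'rV[R]_n) : R :=
  Num.sqrt (\sum_(i < n) x 0 i ^+ 2).

Definition partial (R : realType) (n : nat) (i : 'I_n) (U : 'rV[R]_n -> R) :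
  'rV[R]_n -> R := fun x => 'D_(delta_mx 0 i) U x.

Definition gradient (R : realType) (n : nat) (U : 'rV[R]_n -> R)
  (x : 'rV[R]_n) : 'rV[R]_n := \row_i partial i U x.

Definition hessian (R : realType) (n : nat) (U : 'rV[R]_n -> R)
  (x : 'rV[R]_n) : 'M[R]_n := \matrix_(i, j) partial j (partial i U) x.

Definition class_C2 (R : realType) (n : nat) (U : 'rV[R]_n -> R) : Prop :=
  [/\ forall x, differentiable U x,
      forall i x, differentiable (partial i U) x
    & forall i j, continuous (partial j (partial i U))].

Definition area_element (R : realType) (n : nat) (U : 'rV[R]_n -> R)
  (x : 'rV[R]_n) : R := Num.sqrt (1 + enorm (gradient U x) ^+ 2).

(* In the chart x |-> (x, U x), with x a row vector:
   g_ij = delta_ij + D_i U D_j U. *)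
Definition first_fundamental_form (R : realType) (n : nat)
    (U : 'rV[R]_n -> R) (x : 'rV[R]_n) : 'M[R]_n :=
  1%:M + (gradient U x)^T *m gradient U x.

(* Taken with respect to the upward unit normal (-DU, 1) / sqrt(1 + |DU|^2),
   so that it is nonnegative when U is convex. *)
Definition second_fundamental_form (R : realType) (n : nat)
    (U : 'rV[R]_n -> R) (x : 'rV[R]_n) : 'M[R]_n :=
  (area_element U x)^-1 *: hessian U x.

Definition shape_operator (R : realType) (n : nat) (U : 'rV[R]_n -> R)
    (x : 'rV[R]_n) : 'M[R]_n :=
  invmx (first_fundamental_form U x) *m second_fundamental_form U x.

(* lam lists the eigenvalues of the shape operator with multiplicity. *)
Definition principal_curvatures (R : realType) (n : nat)
    (U : 'rV[R]_n -> R) (x : 'rV[R]_n) (lam : 'rV[R]_n) : Prop :=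
  char_poly (shape_operator U x) = \prod_(i < n) ('X - (lam 0 i)%:P).

Definition positive_cone (R : realType) (n : nat) : set 'rV[R]_n :=
  [set lam | forall i, 0 < lam 0 i].

Definition S_n (R : realType) (n : nat) (lam : 'rV[R]_n) : R :=
  \prod_(i < n) lam 0 i.

(* Used on the positive cone only, where powR is the n-th root. *)
Definition speed (R : realType) (n : nat) (lam : 'rV[R]_n) : R :=
  S_n lam `^ n%:R^-1.

Definition translator (R : realType) (n : nat) (U : 'rV[R]_n -> R) : Prop :=
  forall x, exists lam : 'rV[R]_n,
    [/\ principal_curvatures U x lam, positive_cone lam
      & speed lam = (area_element U x)^-1].

Definition strictly_convex (R : realType) (n : nat) (U : 'rV[R]_n -> R) :
    Prop :=
  forall (x y : 'rV[R]_n) (t : R), x != y -> 0 < t < 1 ->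
    U (t *: x + (1 - t) *: y) < t * U x + (1 - t) * U y.

(* U is the bowl-type solution with profile u, up to vertical translation.
   Completeness is carried by U being defined on all of R^n: the graph of a
   continuous function on R^n is closed in R^(n+1), hence a complete
   hypersurface.  Only the values of u on [0, +oo[ matter. *)
Definition bowl_type_solution (R : realType) (n : nat) (U : 'rV[R]_n -> R)
    (u : R -> R) : Prop :=
  [/\ class_C2 U, strictly_convex U, forall x, U x = u (enorm x)
    & translator U].

(* Main.v *)
(* Since the graph is radial, at the point r e_0 the Hessian of U is triangular
   with diagonal v'(r), v(r)/r, ..., v(r)/r, where v = u', so that the translator
   equation, which reads det D^2 U = 1 + |DU|^2, becomes
   v' v^(n-1) = (1 + v^2) r^(n-1) with v(0) = 0.  For n = 2 this integrates to
   1 + v^2 = exp(r^2) and for n = 3 to v - atan v = r^3 / 3.  For n >= 4 put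
   m = n - 2: the defect v^m / m - r^n / n has derivative r^(n-1) / v^2, which is
   nonnegative, hence v >= w := (m / n)^(1/m) r^(n/m) >= const * r, and this in
   turn bounds the defect by O(r^m) and v - w by O(r^(2/m - 1)). *)
Require Import Defs.
From mathcomp Require Import all_boot all_order all_algebra.
From mathcomp Require Import all_classical all_reals all_analysis.
From mathcomp Require Import ring lra.
Import Order.TTheory GRing.Theory Num.Theory.
Import numFieldNormedType.Exports.
Local Open Scope classical_set_scope.
Local Open Scope ring_scope.

Set Implicit Arguments.
Unset Strict Implicit.
Unset Printing Implicit Defensive.

(** * Comparison of derivatives and asymptotics *)

Lemma is_derive1_mull (R : realType) (c : R) (f : R -> R) (x d : R) :
  is_derive x 1 f d -> is_derive x 1 (fun y => c * f y) (c * d).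
Proof. exact: (is_deriveZ c). Qed.

Lemma is_derive1_sub (R : realType) (f g : R -> R) (x df dg : R) :
  is_derive x 1 f df -> is_derive x 1 g dg ->
  is_derive x 1 (fun y => f y - g y) (df - dg).
Proof. by move=> ? ?; exact: is_deriveB. Qed.

Lemma is_derive1_addl (R : realType) (c : R) (f : R -> R) (x d : R) :
  is_derive x 1 f d -> is_derive x 1 (fun y => c + f y) d.
Proof.
move=> fd.
apply: is_derive_eq (is_deriveD (is_derive_cst c x (1 : R)) fd) _.
by rewrite add0r.
Qed.

Lemma is_derive1_exp (R : realType) (f : R -> R) (k : nat) (x d : R) :
  is_derive x 1 f d ->
  is_derive x 1 (fun y => f y ^+ k) (k%:R * f x ^+ k.-1 * d).
Proof.
move=> fd.
have -> : (fun y => f y ^+ k) = f ^+ k by apply/funext => y; rewrite exprfctE.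
exact: is_deriveX.
Qed.

Lemma derive1_le_sub (R : realType) (f g df dg : R -> R) (a : R) :
  (forall x, a <= x -> is_derive x 1 f (df x)) ->
  (forall x, a <= x -> is_derive x 1 g (dg x)) ->
  (forall x, a < x -> df x <= dg x) ->
  forall r, a <= r -> f r - f a <= g r - g a.
Proof.
move=> fd gd dle r; rewrite le_eqVlt => /predU1P[<-|ar]; first by rewrite !subrr.
have hd x : a <= x -> is_derive x 1 (g - f) (dg x - df x).
  by move=> ax; have ? := fd x ax; have ? := gd x ax; exact: is_deriveB.
have [||c] := @MVT R (g - f) (fun x => dg x - df x) a r ar.
- by move=> x; rewrite in_itv => /andP[/ltW ax _]; exact: hd.
- apply: derivable_within_continuous => x; rewrite in_itv => /andP[ax _].
  by have [] := hd x ax.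
rewrite in_itv => /andP[ac _] e.
have : 0 <= (dg c - df c) * (r - a).
  by rewrite mulr_ge0 ?subr_ge0 ?(ltW ar)// dle.
by rewrite -e !fctE; lra.
Qed.

Lemma derive1_eq_sub (R : realType) (f g df dg : R -> R) (a : R) :
  (forall x, a <= x -> is_derive x 1 f (df x)) ->
  (forall x, a <= x -> is_derive x 1 g (dg x)) ->
  (forall x, a < x -> df x = dg x) ->
  forall r, a <= r -> f r - f a = g r - g a.
Proof.
move=> fd gd e r ar; apply/eqP; rewrite eq_le.
rewrite (derive1_le_sub fd gd _ ar)/=; last by move=> x /e ->.
by rewrite (derive1_le_sub gd fd _ ar)// => x /e ->.
Qed.

Lemma addbigO_pinfty (R : realType) (f g e : R -> R) (C M : R) :
  (forall r, M <= r -> `|f r - g r| <= C * `|e r|) ->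
  forall r, f r = g r +O_(r \near +oo) e r.
Proof.
move=> h r; rewrite bigOE; first by rewrite addrC subrK.
exists C; split; first exact: num_real.
move=> K CK; exists M; split; first exact: num_real.
move=> x /= /ltW /h /le_trans; apply; apply: ler_wpM2r => //; exact: ltW.
Qed.

(** Integrating [|df - dg| <= K * de] over [1, r] bounds [f - g] by [K * e r] plus the constant
    [|f 1 - g 1|], which is absorbed because [e] is eventually at least 1. The base point 1 keeps
    clear of 0, where negative powers and their primitives are singular. *)
Lemma addbigO_derive1 (R : realType) (u f g e df dg de : R -> R) (K M : R) :
  0 <= K -> 0 <= e 1 -> (forall r, M <= r -> 1 <= e r) ->
  (forall r, 0 <= r -> u r = f r) ->
  (forall x : R, 1 <= x -> is_derive x 1 f (df x)) ->
  (forall x : R, 1 <= x -> is_derive x 1 g (dg x)) ->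
  (forall x : R, 1 <= x -> is_derive x 1 e (de x)) ->
  (forall x : R, 1 < x -> `|df x - dg x| <= K * de x) ->
  forall r, u r = g r +O_(r \near +oo) e r.
Proof.
move=> K0 e1 eM uf fd gd ed dle.
have fgd (x : R) : 1 <= x -> is_derive x 1 (f - g) (df x - dg x).
  by move=> x1; have ? := fd x x1; have ? := gd x x1; exact: is_deriveB.
have Ked (x : R) : 1 <= x -> is_derive x 1 (K \*: e) (K * de x).
  by move=> x1; have ? := ed x x1; exact: is_deriveZ.
have Nfgd (x : R) : 1 <= x -> is_derive x 1 (- (f - g)) (- (df x - dg x)).
  by move=> x1; have ? := fgd x x1; exact: is_deriveN.
apply: (@addbigO_pinfty R u g e (`|f 1 - g 1| + K) (Num.max 1 M)) => r.
rewrite ge_max => /andP[r1 /eM er].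
have r0 : 0 <= r by apply: le_trans r1.
rewrite uf// [X in _ * X]ger0_norm; last exact: le_trans er.
have le1 : (f r - g r) - (f 1 - g 1) <= K * e r - K * e 1.
  apply: (@derive1_le_sub R (f - g) (K \*: e) _ _ 1 fgd Ked _ r r1) => x /dle.
  exact/le_trans/ler_norm.
have le2 : - (f r - g r) - - (f 1 - g 1) <= K * e r - K * e 1.
  apply: (@derive1_le_sub R (- (f - g)) (K \*: e) _ _ 1 Nfgd Ked _ r r1).
  by move=> x /dle; apply/le_trans; rewrite -normrN ler_norm.
have Ke1 : 0 <= K * e 1 by rewrite mulr_ge0.
have c1 : f 1 - g 1 <= `|f 1 - g 1| := ler_norm _.
have c2 : - (f 1 - g 1) <= `|f 1 - g 1| by rewrite -normrN ler_norm.
have c3 : `|f 1 - g 1| <= `|f 1 - g 1| * e r by rewrite ler_peMr.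
rewrite ler_norml mulrDl; apply/andP; split; lra.
Qed.

(** * The slope equation *)

(** The equation v' = (1 + v^2) (r / v)^k with denominators cleared, so that it makes sense at r =
    0; [k] stands for n - 1. *)
Definition bowl_slope (R : realType) (k : nat) (v dv : R -> R) : Prop :=
  [/\ forall r : R, is_derive r 1 v (dv r), v 0 = 0, forall r : R, 0 < r -> 0 < v r
    & forall r : R, 0 <= r -> dv r * v r ^+ k = (1 + v r ^+ 2) * r ^+ k].

Lemma is_derive1_Rintegral (R : realType) (f : R -> R) (x : R) :
  0 < x -> continuous f ->
  is_derive x 1 (fun r => \int[lebesgue_measure]_(s in `[0, r]) f s) (f x).
Proof.
move=> x0 cf; have xx1 : x < x + 1 by rewrite ltrDl.
(* The interval reaches beyond [x], which makes [x] interior and the derivative two-sided. *)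
have fi : lebesgue_measure.-integrable `[0, (x + 1)] (EFin \o f).
  apply: continuous_compact_integrable; first exact: segment_compact.
  exact: continuous_subspaceT.
have [dF eF] := continuous_FTC1_closed xx1 fi x0 (cf x).
by rewrite derive1E in eF; exact: DeriveDef dF eF.
Qed.

(** * The cases n = 2 and n = 3, integrated explicitly *)

Lemma bowl_slope2_sqr (R : realType) (v dv : R -> R) :
  bowl_slope 1 v dv -> forall r, 0 <= r -> expR (r ^+ 2) = 1 + v r ^+ 2.
Proof.
move=> [vd v0 _ ode] r r0.
have p x : 0 < 1 + v x ^+ 2 by rewrite ltr_pwDl// sqr_ge0.
(* The equation v v' = (1 + v^2) x says that ln (1 + v^2) and x^2 have the same derivative. *)
have lnd (x : R) : 0 <= x ->
    is_derive x 1 (@ln R \o (fun y => 1 + v y ^+ 2)) (2 * x).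
  move=> x_ge0; have vx := vd x.
  have d1 := is_derive1_addl 1 (is_derive1_exp 2 vx).
  have d2 := @is_derive1_comp R _ (fun y => 1 + v y ^+ 2) _ _ _
    (is_derive1_ln (p x)) d1.
  apply: (is_derive_eq d2).
  have e := ode x x_ge0; rewrite !expr1 in e *.
  rewrite -mulrA (mulrC (v x)) e.
  by field; rewrite gt_eqF.
have sqd (x : R) : 0 <= x -> is_derive x 1 (fun y : R => y ^+ 2) (2 * x).
  move=> _; apply: is_derive_eq (is_derive1_exp 2 (is_derive_id x 1)) _.
  by rewrite expr1 mulr1.
have /= := derive1_eq_sub lnd sqd (fun _ _ => erefl) r0.
rewrite v0 expr0n/= addr0 ln1 !subr0 => <-.
by rewrite lnK// posrE.
Qed.

Lemma bowl_slope3_bound (R : realType) (v dv : R -> R) :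
  bowl_slope 2 v dv -> forall r, 0 <= r -> `|v r - r ^+ 3 / 3| <= pi / 2.
Proof.
move=> [vd v0 _ ode] r r0.
have p x : 0 < 1 + v x ^+ 2 by rewrite ltr_pwDl// sqr_ge0.
have d1 (x : R) : 0 <= x ->
    is_derive x 1 (fun y => v y - y ^+ 3 / 3) (dv x - x ^+ 2).
  move=> _; have vx := vd x.
  under eq_fun do rewrite [_ / 3]mulrC.
  have d2 := is_derive1_mull 3^-1 (is_derive1_exp 3 (is_derive_id x (1 : R))).
  by apply: is_derive_eq (is_derive1_sub vx d2) _; rewrite /=; field.
have d2 (x : R) : 0 <= x ->
    is_derive x 1 (atan \o v) ((1 + v x ^+ 2)^-1 * dv x).
  by move=> _; exact: is_derive1_comp (is_derive1_atan (v x)) (vd x).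
(* Since x^2 = v' v^2 / (1 + v^2), the difference v' - x^2 is the derivative of atan v; hence v -
   r^3 / 3 equals atan v, which is bounded by pi / 2. *)
have e (x : R) : 0 < x -> dv x - x ^+ 2 = (1 + v x ^+ 2)^-1 * dv x.
  move=> x_gt0; have x2 := ode x (ltW x_gt0).
  have -> : x ^+ 2 = dv x * v x ^+ 2 / (1 + v x ^+ 2).
    by rewrite x2 mulrAC divff ?mul1r ?gt_eqF.
  by field; rewrite gt_eqF.
have /= := derive1_eq_sub d1 d2 e r0.
rewrite v0 atan0 expr0n/= mul0r !subr0 => ->.
by rewrite ler_norml !ltW ?atan_ltpi2 ?atan_gtNpi2.
Qed.

Lemma bowl_asymp2 (R : realType) (u phi v dv : R -> R) :
  (forall r, 0 <= r -> u r = phi r) -> (forall r : R, is_derive r 1 phi (v r)) ->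
  bowl_slope 1 v dv ->
  forall r : R, u r = \int[lebesgue_measure]_(s in `[0, r]) expR (s ^+ 2 / 2)
      +O_(r \near +oo) (\int[lebesgue_measure]_(s in `[0, r])
                           Num.sqrt (expR (s ^+ 2 / 2) - 1)).
Proof.
move=> uphi phid vs; have [_ _ vp _] := vs.
have sqc : continuous (fun s : R => s ^+ 2 / 2).
  by move=> s; apply: cvgMl; exact: exprn_continuous.
have Ec : continuous (fun s : R => expR (s ^+ 2 / 2)).
  by move=> s; apply: (continuous_comp (sqc s)); exact: continuous_expR.
have Ec' : continuous (fun s : R => Num.sqrt (expR (s ^+ 2 / 2) - 1)).
  move=> s.
  apply: (@continuous_comp _ _ _ (fun s : R => expR (s ^+ 2 / 2) - 1) Num.sqrt).
    by apply: cvgB; [exact: Ec | exact: cvg_cst].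
  exact: sqrt_continuous.
set e := fun r : R =>
  \int[lebesgue_measure]_(s in `[0, r]) Num.sqrt (expR (s ^+ 2 / 2) - 1).
have ed (x : R) : 1 <= x -> is_derive x 1 e (Num.sqrt (expR (x ^+ 2 / 2) - 1)).
  by move=> x1; apply: is_derive1_Rintegral => //; exact: lt_le_trans x1.
have de_ge (x : R) : 1 <= x -> 2^-1 <= Num.sqrt (expR (x ^+ 2 / 2) - 1).
  move=> x1; have x2 : 1 <= x ^+ 2 by rewrite exprn_ege1.
  have h : 1 / 2 <= x ^+ 2 / 2 by lra.
  (* From exp y >= 1 + y and y >= 1/2, the radicand is at least 1/2, hence at least (1/2)^2. *)
  have := expR_ge1Dx (x ^+ 2 / 2); move: h; set y := x ^+ 2 / 2 => h hy.
  by rewrite -[2^-1]ger0_norm ?invr_ge0// -sqrtr_sqr ler_sqrt; lra.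
have e_ge0 r : 0 <= e r by apply: Rintegral_ge0 => s _; exact: sqrtr_ge0.
have e_ge (r : R) : 1 <= r -> (r - 1) / 2 <= e r.
  move=> r1.
  have d1 (x : R) : 1 <= x -> is_derive x 1 (fun y : R => 2^-1 * y) (2^-1 * 1).
    by move=> _; exact: is_derive1_mull (is_derive_id x (1 : R)).
  have dle (x : R) : 1 < x -> 2^-1 * 1 <= Num.sqrt (expR (x ^+ 2 / 2) - 1).
    by move=> x1; rewrite mulr1 de_ge// ltW.
  have := derive1_le_sub d1 ed dle r1; have := e_ge0 1; rewrite /=; lra.
(* With y = exp (x^2 / 2), v^2 = y^2 - 1 gives 0 <= y - v = 1 / (y + v) <= 1, and 1 is at most [2]
   times the error density by [de_ge]. The threshold [3] makes (r - 1) / 2 >= 1. *)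
apply: (@addbigO_derive1 _ u phi _ e v (fun x => expR (x ^+ 2 / 2))
  (fun x => Num.sqrt (expR (x ^+ 2 / 2) - 1)) 2 3) => //.
- by move=> r r3; apply: le_trans (e_ge r _); lra.
- by move=> x x1; apply: is_derive1_Rintegral => //; exact: lt_le_trans x1.
- move=> x x1; have x0 : 0 <= x by lra.
  have := bowl_slope2_sqr vs x0; have := vp x; have := de_ge x (ltW x1).
  have -> : expR (x ^+ 2) = expR (x ^+ 2 / 2) ^+ 2 by rewrite -expRM_natl mulrC divfK.
  have := expR_gt0 (x ^+ 2 / 2); set y := expR _.
  move=> y0 ? vx eq; have {}vx : 0 < v x by apply: vx; lra.
  rewrite ler_norml; apply/andP; split; nra.
Qed.

Lemma bowl_asymp3 (R : realType) (u phi v dv : R -> R) :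
  (forall r, 0 <= r -> u r = phi r) -> (forall r : R, is_derive r 1 phi (v r)) ->
  bowl_slope 2 v dv -> forall r : R, u r = r ^+ 4 / 12 +O_(r \near +oo) r.
Proof.
move=> uphi phid vs.
apply: (@addbigO_derive1 _ u phi _ id v (fun x => x ^+ 3 / 3) (cst 1) (pi / 2) 1) => //.
- by rewrite divr_ge0 ?pi_ge0.
- move=> x _; under eq_fun do rewrite [_ / 12]mulrC.
  apply: is_derive_eq (is_derive1_mull 12^-1 (is_derive1_exp 4 (is_derive_id x (1 : R)))) _.
  by rewrite /=; field.
- by move=> x x1; rewrite mulr1 (bowl_slope3_bound vs)//; lra.
Qed.

(** * The case n >= 4, with m = n - 2 *)

Definition slope_defect (R : realType) (m : nat) (v : R -> R) (r : R) : R :=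
  m%:R^-1 * v r ^+ m - m.+2%:R^-1 * r ^+ m.+2.

Lemma is_derive_slope_defect (R : realType) (m : nat) (v dv : R -> R) :
  (0 < m)%N -> bowl_slope m.+1 v dv -> forall r : R,
  is_derive r 1 (slope_defect m v) (v r ^+ m.-1 * dv r - r ^+ m.+1).
Proof.
move=> m0 [vd _ _ _] r.
have d1 := is_derive1_mull m%:R^-1 (is_derive1_exp m (vd r)).
have d2 := is_derive1_mull m.+2%:R^-1 (is_derive1_exp m.+2 (is_derive_id r (1 : R))).
apply: is_derive_eq (is_derive1_sub d1 d2) _ => /=.
by rewrite mulr1 -(mulrA m%:R) !mulKf// pnatr_eq0// -lt0n.
Qed.

(** Dividing the equation by v^2 splits its right side into r^(m+1), which the defect subtracts, and
    the contribution r^(m+1) / v^2 of the summand 1 in 1 + v^2. *)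
Lemma slope_defect_derivE (R : realType) (m : nat) (v dv : R -> R) :
  (0 < m)%N -> bowl_slope m.+1 v dv -> forall r, 0 < r ->
  v r ^+ m.-1 * dv r - r ^+ m.+1 = r ^+ m.+1 / v r ^+ 2.
Proof.
move=> m0 [_ _ vp ode] r r0; have v0 := vp r r0.
have := ode r (ltW r0); case: m m0 {ode} => // m _; rewrite !(exprS _ m.+1) (exprS _ m) /= => e.
apply: (mulIf (x := v r ^+ 2)); first by rewrite gt_eqF ?exprn_gt0.
rewrite divfK ?gt_eqF ?exprn_gt0//.
by rewrite !expr2 in e *; set a := _ ^+ m in e *; nra.
Qed.

Lemma slope_defect_ge0 (R : realType) (m : nat) (v dv : R -> R) :
  (0 < m)%N -> bowl_slope m.+1 v dv -> forall r, 0 <= r -> 0 <= slope_defect m v r.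
Proof.
move=> m0 vs r r0; have [_ v0 _ _] := vs.
have c0 (x : R) : 0 <= x -> is_derive x 1 (cst 0 : R -> R) (cst 0 x).
  by move=> _; exact: is_derive_cst.
have ge0 (x : R) : 0 < x -> cst 0 x <= v x ^+ m.-1 * dv x - x ^+ m.+1.
  move=> x0; rewrite (slope_defect_derivE m0 vs x0).
  by rewrite /= divr_ge0 ?sqr_ge0// exprn_ge0// ltW.
have := derive1_le_sub c0 (fun x _ => is_derive_slope_defect m0 vs x) ge0 r0.
by rewrite /= subrr /slope_defect v0 !expr0n -(prednK m0)/= !mulr0 !subr0.
Qed.

(** The function w of vanishing defect, i.e. w^m / m = r^(m+2) / (m+2); it solves the equation with
    1 + v^2 replaced by v^2. *)
Definition model_slope (R : realType) (m : nat) (r : R) : R :=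
  (m%:R / m.+2%:R) `^ m%:R^-1 * r `^ (1 + 2 / m%:R).

Lemma model_slope_ge0 (R : realType) (m : nat) (r : R) : 0 <= model_slope m r.
Proof. by rewrite mulr_ge0 ?powR_ge0. Qed.

Lemma model_slope_exp (R : realType) (m : nat) (r : R) :
  (0 < m)%N -> 0 <= r -> model_slope m r ^+ m = m%:R / m.+2%:R * r ^+ m.+2.
Proof.
move=> m0 r0; have mR : 0 < m%:R :> R by rewrite ltr0n.
rewrite exprMn -!powR_mulrn ?powR_ge0//.
rewrite -!powRrM mulVf ?gt_eqF// powRr1 ?divr_ge0//; congr (_ * _ `^ _).
by rewrite mulrDl mul1r divfK ?gt_eqF// -[m.+2]addn2 natrD.
Qed.

Lemma model_slope_le (R : realType) (m : nat) (v dv : R -> R) :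
  (0 < m)%N -> bowl_slope m.+1 v dv ->
  forall r, 0 <= r -> model_slope m r <= v r.
Proof.
move=> m0 vs r; have mR : 0 < m%:R :> R by rewrite ltr0n.
have [_ v0 vp _] := vs; rewrite le_eqVlt => /predU1P[<-|r0].
  by rewrite v0 /model_slope powR0 ?mulr0// gt_eqF// addr_gt0 ?divr_gt0.
have := slope_defect_ge0 m0 vs (ltW r0); rewrite subr_ge0 => h.
rewrite -(ler_pXn2r m0) ?nnegrE ?(ltW (vp _ r0)) ?model_slope_ge0//.
by rewrite model_slope_exp ?(ltW r0)// -mulrA -ler_pdivlMl// mulrA (le_trans _ h)// mulrC.
Qed.

(** A linear lower bound v >= c r turns the derivative r^(m+1) / v^2 of the defect into at most
    c^(-2) r^(m-1), whose integral is O(r^m). *)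
Lemma slope_defect_le (R : realType) (m : nat) (v dv : R -> R) :
  (0 < m)%N -> bowl_slope m.+1 v dv ->
  exists2 K, 0 <= K & forall r : R, 1 <= r -> slope_defect m v r <= K * r ^+ m.
Proof.
move=> m0 vs; have mR : 0 < m%:R :> R by rewrite ltr0n.
have [_ _ vp _] := vs.
pose c : R := (m%:R / m.+2%:R) `^ m%:R^-1.
have c0 : 0 < c by rewrite powR_gt0// divr_gt0.
(* For r >= 1 the exponent 1 + 2/m of the model may be lowered to 1. *)
have cv (r : R) : 1 <= r -> c * r <= v r.
  move=> r1; have r0 : 0 <= r by apply: le_trans r1.
  apply: le_trans (model_slope_le m0 vs r0).
  apply: ler_wpM2l; first exact: ltW.
  rewrite -[X in X <= _]powRr1// ler_powR//.
  by rewrite lerDl divr_ge0// ltW.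
have dd (r : R) : 1 <= r ->
    is_derive r 1 (fun y : R => c ^- 2 / m%:R * y ^+ m) (c ^- 2 * r ^+ m.-1).
  move=> _.
  apply: is_derive_eq (is_derive1_mull _ (is_derive1_exp m (is_derive_id r (1 : R)))) _.
  by rewrite /= mulr1 mulrA divfK// gt_eqF.
have dle (r : R) : 1 < r ->
    v r ^+ m.-1 * dv r - r ^+ m.+1 <= c ^- 2 * r ^+ m.-1.
  move=> r1; have r0 : 0 < r by apply: lt_trans r1.
  rewrite (slope_defect_derivE m0 vs r0) ler_pdivrMr ?exprn_gt0 ?vp//.
  have -> : r ^+ m.+1 = r ^+ m.-1 * r ^+ 2 by rewrite -exprD addn2 prednK.
  rewrite [c ^- 2 * _]mulrC -mulrA ler_pM2l ?exprn_gt0// ler_pdivlMl ?exprn_gt0//.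
  rewrite -exprMn ler_pXn2r ?nnegrE ?cv ?mulr_ge0 ?ltW ?vp//.
have := derive1_le_sub (fun x _ => is_derive_slope_defect m0 vs x) dd dle.
move=> h; have D1 := slope_defect_ge0 m0 vs (@ler01 R).
exists (slope_defect m v 1 + c ^- 2 / m%:R).
  by rewrite addr_ge0// divr_ge0 ?invr_ge0 ?exprn_ge0 ?ltW.
move=> r r1; rewrite [leRHS]mulrDl; have := h r r1; rewrite /= expr1n mulr1.
have : slope_defect m v 1 <= slope_defect m v 1 * r ^+ m.
  by rewrite ler_peMr ?exprn_ege1.
have : 0 <= c ^- 2 / m%:R by rewrite divr_ge0 ?invr_ge0 ?exprn_ge0 ?ltW.
lra.
Qed.

Lemma slope_gap_le (R : realType) (m : nat) (v dv : R -> R) :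
  (0 < m)%N -> bowl_slope m.+1 v dv ->
  exists2 K, 0 <= K &
    forall r : R, 1 <= r -> `|v r - model_slope m r| <= K * r `^ (2 / m%:R - 1).
Proof.
move=> m0 vs; have [K K0 hK] := slope_defect_le m0 vs.
have mR : 0 < m%:R :> R by rewrite ltr0n.
pose c : R := (m%:R / m.+2%:R) `^ m%:R^-1.
(* The bound reached is v - w <= w m K r^m / w^m = K (m+2) w / r^2, and w / r^2 = c r^(2/m - 1). *)
exists (K * m.+2%:R * c); first by rewrite !mulr_ge0// powR_ge0.
move=> r r1; have r0 : 0 < r by apply: lt_le_trans r1.
have wv := model_slope_le m0 vs (ltW r0).
have w0 := model_slope_ge0 m r.
have v0 := le_trans w0 wv.
have wm := model_slope_exp m0 (ltW r0).
have wE : model_slope m r = c * r `^ (2 / m%:R - 1) * r ^+ 2.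
  rewrite -mulrA -powR_mulrn ?(ltW r0)// -powRD ?(gt_eqF r0) ?implybT//.
  by congr (_ * _ `^ _); ring.
rewrite ger0_norm ?subr_ge0//.
have := hK r r1; rewrite /slope_defect.
move: wm wE wv w0; set w := model_slope m r => wm wE wv w0 h.
(* The difference of the two sides is w v (v^(m-1) - w^(m-1)), nonnegative since v >= w. This passes
   from m-th powers to the slopes themselves. *)
have cvx : w ^+ m * (v r - w) <= w * (v r ^+ m - w ^+ m).
  have : w ^+ m.-1 <= v r ^+ m.-1 by rewrite lerXn2r.
  rewrite -(prednK m0) !exprS /=; set a := w ^+ _; set b := v r ^+ _ => ab.
  have : 0 <= w * v r * (b - a) by apply: mulr_ge0; [exact: mulr_ge0 | rewrite subr_ge0].
  nra.
have wmp : 0 < w ^+ m by rewrite wm mulr_gt0 ?divr_gt0 ?exprn_gt0.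
rewrite -(ler_pM2l wmp); apply: le_trans cvx _.
have vle : v r ^+ m - w ^+ m <= m%:R * (K * r ^+ m).
  rewrite wm -ler_pdivrMl//; apply: le_trans h.
  by rewrite mulrBr !mulrA mulVf ?mul1r ?gt_eqF.
apply: le_trans (ler_wpM2l w0 vle) _.
rewrite {1}wE wm !exprS expr0 le_eqVlt; apply/orP; left; apply/eqP.
field.
by rewrite gt_eqF// (_ : m%:R + 2 = m.+2%:R)// -addn2 natrD.
Qed.

Lemma bowl_asymp_large (R : realType) (m : nat) (u phi v dv : R -> R) :
  (0 < m)%N ->
  (forall r, 0 <= r -> u r = phi r) -> (forall r : R, is_derive r 1 phi (v r)) ->
  bowl_slope m.+1 v dv ->
  forall r : R, u r =
    (m%:R / m.+2%:R) `^ m%:R^-1 / (2 + 2 / m%:R) * r `^ (2 + 2 / m%:R)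
    +O_(r \near +oo) (r `^ (2 / m%:R)).
Proof.
move=> m0 uphi phid vs; have [K K0 hK] := slope_gap_le m0 vs.
have mR : 0 < m%:R :> R by rewrite ltr0n.
have p0 : 0 < 2 / m%:R :> R by rewrite divr_gt0.
(* The factor [m%:R / 2] cancels the 2/m produced by differentiating r^(2/m). *)
apply: (@addbigO_derive1 _ u phi _ (fun r => r `^ (2 / m%:R)) v (@model_slope R m)
  (fun r => 2 / m%:R * r `^ (2 / m%:R - 1)) (K * (m%:R / 2)) 1).
- by rewrite mulr_ge0// divr_ge0// ltW.
- exact: powR_ge0.
- by move=> r r1; rewrite -[X in X <= _](powRr0 r) ler_powR// ltW.
- exact: uphi.
- move=> x x1; have x0 : 0 < x by apply: lt_le_trans x1.
  apply: is_derive_eq (is_derive1_mull _ (is_derive1_powR (2 + 2 / m%:R) x0)) _.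
  rewrite mulrA divfK ?gt_eqF ?addr_gt0//; congr (_ * _ `^ _); ring.
- by move=> x x1; apply: is_derive1_powR; apply: lt_le_trans x1.
- move=> x x1; apply: le_trans (hK x (ltW x1)) _.
  rewrite [leRHS](_ : _ = K * x `^ (2 / m%:R - 1))//.
  by field; rewrite gt_eqF.
Qed.

(** * The slope of a radial translator *)

Lemma is_derive_line (R : realType) (V : normedModType R) (F : V -> R) (x d : V)
    (t : R) :
  derivable F (x + t *: d) d ->
  is_derive t 1 (fun s => F (x + s *: d)) ('D_d F (x + t *: d)).
Proof.
have e : (fun h : R => h^-1 *: ((F \o shift (x + t *: d)) (h *: d)
           - F (x + t *: d))) =
         (fun h : R => h^-1 *: (((fun s => F (x + s *: d)) \o shift t) (h *: (1 : R))
           - F (x + t *: d))).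
  apply/funext => h /=; congr (_ *: (F _ - _)).
  by rewrite [h *: 1]mulr1 scalerDl addrCA.
rewrite /derivable e => dF; apply: DeriveDef; first exact: dF.
by rewrite /derive e.
Qed.

(** * The translator equation as a determinant equation *)

Lemma char_poly_split_det (R : comNzRingType) (n : nat) (A : 'M[R]_n)
    (a : 'I_n -> R) :
  char_poly A = \prod_(i < n) ('X - (a i)%:P) -> \det A = \prod_(i < n) a i.
Proof.
(* Compare constant coefficients: both sides carry the sign (-1)^n. *)
move=> cA; have := char_poly_det A.
rewrite cA -horner_coef0 horner_prod.
under eq_bigr do rewrite hornerXsubC sub0r.
rewrite prodrN cardT size_enum_ord => /(congr1 ( *%R ((-1) ^+ n))).
by rewrite !signrMK.
Qed.

Lemma det_first_fundamental_form (R : realType) (n : nat)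
    (U : 'rV[R]_n.+1 -> R) (x : 'rV[R]_n.+1) :
  (forall i, i != 0 -> partial i U x = 0) ->
  \det (first_fundamental_form U x) = 1 + partial 0 U x ^+ 2.
Proof.
move=> U0; have gE i j : first_fundamental_form U x i j =
    (i == j)%:R + partial i U x * partial j U x.
  by rewrite !mxE big_ord_recl big_ord0 addr0 !mxE.
rewrite det_trig; last first.
  apply/is_trig_mxP => i j ij; rewrite gE (U0 j) ?mulr0 ?addr0.
    by rewrite (negbTE (_ : i != j))// neq_ltn ij.
  by rewrite -val_eqE /= -lt0n (leq_ltn_trans _ ij).
rewrite big_ord_recl gE eqxx big1 ?mulr1// => i _.
by rewrite gE eqxx U0 ?mulr0 ?addr0.
Qed.

Lemma area_element_sqr (R : realType) (n : nat) (U : 'rV[R]_n -> R) (x : 'rV[R]_n) :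
  area_element U x ^+ 2 = 1 + \sum_i partial i U x ^+ 2.
Proof.
have s0 : 0 <= \sum_i partial i U x ^+ 2 by apply: sumr_ge0 => i _; exact: sqr_ge0.
have eE : enorm (gradient U x) = Num.sqrt (\sum_i partial i U x ^+ 2).
  by congr Num.sqrt; apply: eq_bigr => i _; rewrite mxE.
by rewrite sqr_sqrtr eE sqr_sqrtr// addr_ge0.
Qed.

(** Let W be the area element and N = n + 1 the dimension. The Gauss curvature is W^(-N) det D^2 U /
    W^2, while the N-th power of the speed equation makes it W^(-N); cancelling leaves det D^2 U =
    W^2. *)
Lemma translator_det_hessian (R : realType) (n : nat)
    (U : 'rV[R]_n.+1 -> R) (x : 'rV[R]_n.+1) :
  translator U -> (forall i, i != 0 -> partial i U x = 0) ->
  \det (hessian U x) = 1 + partial 0 U x ^+ 2.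
Proof.
move=> /(_ x) [lam [/char_poly_split_det lamE lam0 spd]] U0.
have aE : area_element U x ^+ 2 = 1 + partial 0 U x ^+ 2.
  rewrite area_element_sqr big_ord_recl [X in _ + (_ + X)]big1 ?addr0// => i _.
  by rewrite U0 ?expr0n.
have S0 : 0 < S_n lam by apply: prodr_gt0 => i _; exact: lam0.
have w0 : 0 < area_element U x.
  by rewrite sqrtr_gt0 ltr_pwDl// sqr_ge0.
move: lamE; rewrite det_mulmx det_inv detZ det_first_fundamental_form// -aE.
rewrite -/(S_n lam).
have -> : S_n lam = area_element U x ^- n.+1.
  rewrite -exprVn -spd -powR_mulrn ?powR_ge0// -powRrM mulVf ?pnatr_eq0//.
  by rewrite powRr1// ltW.
rewrite exprVn; set q := _ ^- _ => e.
have q0 : q != 0 by rewrite invr_neq0// expf_neq0// gt_eqF.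
apply: (mulfI q0); rewrite -[in RHS]e; field.
by rewrite gt_eqF.
Qed.

Lemma is_derive_unique (R : numFieldType) (V W : normedModType R) (f : V -> W)
    (x d : V) (a b : W) :
  is_derive x d f a -> is_derive x d f b -> a = b.
Proof. by move=> [_ <-] [_ <-]. Qed.

(** The chain rule applied to g(-s) = g(s) at 0 gives -d = d. *)
Lemma is_derive1_even (R : realType) (g : R -> R) (d : R) :
  is_derive (0 : R) 1 g d -> (forall s, g (- s) = g s) -> d = 0.
Proof.
move=> gd ge; have Nd := is_deriveN (is_derive_id (0 : R) (1 : R)).
have gd0 : is_derive (- (0 : R)) 1 g d by rewrite oppr0.
have gN : g \o -%R = g by apply/funext => s /=; rewrite ge.
have := @is_derive1_comp R g (-%R) 0 _ _ gd0 Nd; rewrite gN mulrN1 => /is_derive_unique.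
by move=> /(_ _ gd); lra.
Qed.

Lemma is_derive_axis (R : realType) (n : nat) (i : 'I_n) (F : 'rV[R]_n -> R)
    (x : 'rV[R]_n) (t : R) :
  differentiable F (x + t *: delta_mx 0 i) ->
  is_derive t 1 (fun s => F (x + s *: delta_mx 0 i))
    (partial i F (x + t *: delta_mx 0 i)).
Proof. by move=> dF; apply/is_derive_line/diff_derivable. Qed.

Lemma enorm_eq (R : realType) (n : nat) (x y : 'rV[R]_n) :
  (forall i, `|x 0 i| = `|y 0 i|) -> enorm x = enorm y.
Proof.
move=> xy; congr Num.sqrt; apply: eq_bigr => i _.
by rewrite -[LHS]real_normK ?num_real// xy real_normK ?num_real.
Qed.

Lemma enorm_axis2 (R : realType) (n : nat) (i : 'I_n.+1) (r t : R) :
  i != 0 -> enorm (r *: delta_mx 0 0 + t *: delta_mx 0 i : 'rV[R]_n.+1) =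
            Num.sqrt (r ^+ 2 + t ^+ 2).
Proof.
move=> i0; congr Num.sqrt; rewrite (bigD1 0)//= (bigD1 i)//= big1 ?addr0.
  have i0' : (0 == i) = false by rewrite eq_sym (negbTE i0).
  by rewrite !mxE !eqxx (negbTE i0) i0' /= !(mulr1, mulr0) addr0 add0r.
move=> j /andP[j0 ji].
by rewrite !mxE (negbTE j0) (negbTE ji)/= !mulr0 addr0 expr0n.
Qed.

Lemma enorm_axis (R : realType) (n : nat) (t : R) :
  enorm (t *: delta_mx 0 0 : 'rV[R]_n.+1) = `|t|.
Proof.
rewrite -sqrtr_sqr; congr Num.sqrt; rewrite (bigD1 0)//= big1 ?addr0.
  by rewrite !mxE !eqxx mulr1.
by move=> j j0; rewrite !mxE (negbTE j0) mulr0 expr0n.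
Qed.

(** * Derivatives of a radial function along the first axis *)

Section radial.
Context (R : realType) (n : nat) (U : 'rV[R]_n.+1 -> R) (u : R -> R).
Hypothesis Uu : forall x, U x = u (enorm x).
Hypothesis U2 : class_C2 U.

Let e (i : 'I_n.+1) : 'rV[R]_n.+1 := delta_mx 0 i.
Let phi (t : R) := U (t *: e 0).
Let v (t : R) := partial 0 U (t *: e 0).
Let dv (t : R) := hessian U (t *: e 0) 0 0.

(** Reflecting the i-th coordinate preserves the norm, so [U] is even along the i-th direction
    through such a point. *)
Lemma radial_partial0 i (x : 'rV[R]_n.+1) : x 0 i = 0 -> partial i U x = 0.
Proof.
move=> xi; have [dU _ _] := U2.
have := @is_derive_axis R _ i U x 0 (dU _).
rewrite scale0r addr0 => /is_derive1_even; apply => s.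
rewrite !Uu; congr u; apply: enorm_eq => j; rewrite !mxE.
have [<-|_] := eqVneq i j; first by rewrite xi !add0r mulNr normrN.
by rewrite andbF !mulr0.
Qed.

Lemma radial_phi (t : R) : is_derive t 1 phi (v t).
Proof.
have [dU _ _] := U2; have := @is_derive_axis R _ 0 U 0 t (dU _).
by rewrite add0r; under eq_fun do rewrite add0r.
Qed.

Lemma radial_v (t : R) : is_derive t 1 v (dv t).
Proof.
have [_ dU _] := U2; have := @is_derive_axis R _ 0 (partial 0 U) 0 t (dU _ _).
by rewrite add0r /dv mxE; under eq_fun do rewrite add0r.
Qed.

Lemma radialE (x : 'rV[R]_n.+1) : U x = phi (enorm x).
Proof. by rewrite /phi !Uu enorm_axis ger0_norm// sqrtr_ge0. Qed.

(** Moving from r e_0 in direction e_j keeps the i-th coordinate at 0, so the i-th partial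
    derivative vanishes along that whole line. *)
Lemma radial_hessian_trig (r : R) i j : i != 0 -> i != j -> hessian U (r *: e 0) i j = 0.
Proof.
move=> i0 ij; have [_ dU _] := U2.
have := @is_derive_axis R _ j (partial i U) (r *: e 0) 0 (dU _ _).
rewrite scale0r addr0 mxE => /is_derive_unique; apply.
rewrite (_ : (fun _ => _) = cst 0); first exact: is_derive_cst.
apply/funext => s /=; apply: radial_partial0.
by rewrite !mxE (negbTE i0) (negbTE ij) /= !mulr0 addr0.
Qed.

Lemma radial_hessian_diag (r : R) i : 0 < r -> i != 0 ->
  hessian U (r *: e 0) i i = v r / r.
Proof.
move=> r0 i0; have [dU ddU _] := U2.
pose s (t : R) := Num.sqrt (r ^+ 2 + t ^+ 2).
have s2 t : 0 < r ^+ 2 + t ^+ 2 by rewrite ltr_pwDl ?sqr_ge0// exprn_gt0.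
have s0 t : 0 < s t by rewrite sqrtr_gt0.
have sd (t : R) : is_derive t 1 s (t / s t).
  have d1 := is_derive1_addl (r ^+ 2) (is_derive1_exp 2 (is_derive_id t (1 : R))).
  have d2 := @is_derive1_comp R _ (fun y => r ^+ 2 + y ^+ 2) _ _ _
    (is_derive1_sqrt (s2 t)) d1.
  apply: (is_derive_eq d2); rewrite -/(s t) /=.
  by field; rewrite gt_eqF.
(* Along this line [U] is phi (s t) with s' = t / s. In the product rule at t = 0 the factor t then
   kills the derivative of v(s) / s, leaving v(r) / r. *)
have pE t : partial i U (r *: e 0 + t *: e i) = t * (v (s t) / s t).
  have := @is_derive_axis R _ i U (r *: e 0) t (dU _).
  move=> /is_derive_unique; apply.
  rewrite (_ : (fun _ => _) = phi \o s); last first.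
    by apply/funext => y /=; rewrite radialE enorm_axis2.
  apply: is_derive_eq (is_derive1_comp (radial_phi (s t)) (sd t)) _.
  by rewrite mulrCA.
have := @is_derive_axis R _ i (partial i U) (r *: e 0) 0 (ddU _ _).
rewrite scale0r addr0 mxE => /is_derive_unique; apply.
have vd := is_derive1_comp (radial_v (s 0)) (sd 0).
have sV := is_deriveV (lt0r_neq0 (s0 0)) (sd 0).
have qd := is_deriveM vd sV.
have td := is_deriveM (is_derive_id (0 : R) (1 : R)) qd.
rewrite (_ : (fun _ => _) = id * ((v \o s) * (fun y => (s y)^-1))); last first.
  by apply/funext => y /=; rewrite pE.
apply: (is_derive_eq td).
rewrite scale0r add0r [LHS]mulr1 -[LHS]/(v (s 0) / s 0).
by have -> : s 0 = r by rewrite /s expr0n addr0 sqrtr_sqr ger0_norm// ltW.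
Qed.

Lemma radial_det_hessian (r : R) : 0 < r ->
  \det (hessian U (r *: e 0)) = dv r * (v r / r) ^+ n.
Proof.
(* Row 0 is left unrestricted, so the Hessian is upper triangular; the transpose has the lower
   triangular form of [det_trig]. *)
move=> r0; rewrite -det_tr det_trig; last first.
  apply/is_trig_mxP => i j ij; rewrite mxE radial_hessian_trig//.
    by rewrite -val_eqE /= -lt0n (leq_ltn_trans _ ij).
  by rewrite neq_ltn ij orbT.
rewrite big_ord_recl mxE; congr (_ * _).
transitivity (\prod_(i < n) (v r / r)); last by rewrite prodr_const card_ord.
by apply: eq_bigr => i _; rewrite mxE radial_hessian_diag.
Qed.

(** Write x as the convex combination t y + (1 - t)(-y), so t = (x + y) / (2 y); as phi is even,
    strict convexity gives phi x < phi y. *)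
Lemma radial_phi_increasing : strictly_convex U ->
  {in `[0, +oo[ &, {homo phi : x y / x < y}}.
Proof.
move=> cU x y; rewrite !in_itv /= !andbT => x0 y0 xy.
have y_gt0 : 0 < y := le_lt_trans x0 xy.
pose t := (x + y) / (2 * y).
have t01 : 0 < t < 1.
  by rewrite divr_gt0 ?mulr_gt0 ?ltr_wpDl//= ltr_pdivrMr ?mulr_gt0//; lra.
have ne : y *: e 0 != - y *: e 0.
  apply/eqP => /matrixP/(_ 0 0); rewrite !mxE !eqxx !mulr1; lra.
have := cU _ _ t ne t01.
rewrite -/(phi y) -/(phi (- y)) !scalerA -scalerDl.
have -> : t * y + (1 - t) * - y = x by rewrite /t; field; rewrite gt_eqF.
have -> : phi (- y) = phi y by rewrite /phi !Uu !enorm_axis normrN.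
by rewrite -/(phi x); lra.
Qed.

Lemma radial_bowl_slope : (0 < n)%N -> strictly_convex U -> translator U ->
  bowl_slope n v dv.
Proof.
move=> n0 cU tU.
have v0 : v 0 = 0 by apply: radial_partial0; rewrite scale0r mxE.
have ode (r : R) : 0 < r -> dv r * (v r / r) ^+ n = 1 + v r ^+ 2.
  move=> r0; rewrite -radial_det_hessian// translator_det_hessian// => i i0.
  by apply: radial_partial0; rewrite !mxE (negbTE i0) mulr0.
split=> [r||r r0|r]; first exact: radial_v.
- exact: v0.
- have : 0 <= v r.
    have [_ <-] := radial_phi r; rewrite -derive1E.
    apply: (incr_derive1_ge0_itvy (b0 := true) (a := 0)).
    + by move=> x _; have [] := radial_phi x.
    + exact: radial_phi_increasing.
    + by rewrite in_itv /= r0.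
  (* Monotonicity only gives v >= 0; if v r = 0, the equation would read 0 = 1 because n > 0. *)
  rewrite le_eqVlt => /predU1P[vr|//]; have := ode r r0.
  by rewrite -vr mul0r !expr0n -(prednK n0)/= mulr0; lra.
- rewrite le_eqVlt => /predU1P[<-|r0].
    by rewrite v0 !expr0n -(prednK n0)/= !mulr0.
  by rewrite -ode// exprMn exprVn mulrA divfK// expf_neq0// gt_eqF.
Qed.
End radial.

(* The hypothesis says nothing about u on the negative half-line, so derivatives
   are taken of an even function phi that agrees with u on [0, +oo[. *)
Lemma bowl_profile (R : realType) (n : nat) (U : 'rV[R]_n.+2 -> R) (u : R -> R) :
  bowl_type_solution U u ->
  exists phi v dv : R -> R,
    [/\ forall r, 0 <= r -> u r = phi r, forall r : R, is_derive r 1 phi (v r)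
      & bowl_slope n.+1 v dv].
Proof.
move=> [U2 cU Uu tU].
exists (fun t => U (t *: delta_mx 0 0)), (fun t => partial 0 U (t *: delta_mx 0 0)),
  (fun t => hessian U (t *: delta_mx 0 0) 0 0); split.
- by move=> r r0; rewrite Uu enorm_axis ger0_norm.
- by move=> r; exact: radial_phi.
- exact: (radial_bowl_slope Uu).
Qed.

Unset Implicit Arguments.

Theorem theorem1p3 (R : realType) (n : nat) (U : 'rV[R]_n -> R) (u : R -> R)
    (hn : (2 <= n)%N) (hU : bowl_type_solution U u) :
  [/\ n = 2%N -> forall r : R,
        u r = \int[lebesgue_measure]_(s in `[0, r]) expR (s ^+ 2 / 2)
          +O_(r \near +oo) (\int[lebesgue_measure]_(s in `[0, r])
                               Num.sqrt (expR (s ^+ 2 / 2) - 1)),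
      n = 3%N -> forall r : R, u r = r ^+ 4 / 12 +O_(r \near +oo) r
    & (4 <= n)%N -> forall r : R,
        u r = (n%:R - 2) `^ ((n%:R - 1) / (n%:R - 2))
                / (2 * (n%:R - 1) * n%:R `^ (1 / (n%:R - 2)))
                * r `^ (2 * (n%:R - 1) / (n%:R - 2))
          +O_(r \near +oo) (r `^ (2 / (n%:R - 2)))].
Proof.
(* With n = k + 2, the slope equation has exponent k + 1 and the m of the large case is [k]. *)
case: n U hn hU => [|[|k]]// U _ /bowl_profile [phi [v [dv [uphi phid vs]]]].
split=> [[k0]|[k1]|k2].
- by rewrite k0 in vs; exact: bowl_asymp2 uphi phid vs.
- by rewrite k1 in vs; exact: bowl_asymp3 uphi phid vs.
- have k0 : (0 < k)%N by rewrite !ltnS in k2; exact: ltnW.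
  have kR : 0 < k%:R :> R by rewrite ltr0n.
  have nE : k.+2%:R = k%:R + 2 :> R by rewrite -addn2 natrD.
  have nR : 0 < k.+2%:R :> R by rewrite ltr0n.
  have -> : k.+2%:R - 2 = k%:R :> R by rewrite nE addrK.
  have -> : 2 * (k.+2%:R - 1) / k%:R = 2 + 2 / k%:R :> R.
    by rewrite nE; field; rewrite gt_eqF.
  have -> : k%:R `^ ((k.+2%:R - 1) / k%:R)
              / (2 * (k.+2%:R - 1) * k.+2%:R `^ (1 / k%:R))
            = (k%:R / k.+2%:R) `^ k%:R^-1 / (2 + 2 / k%:R) :> R.
    (* Splitting off one factor k turns 2 (k + 1) into 2 + 2/k; the remaining k^(1/k) joins
       n^(-1/k). *)
    rewrite (_ : (k.+2%:R - 1) / k%:R = 1 + k%:R^-1); last first.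
      by rewrite nE; field; rewrite gt_eqF.
    rewrite powRD ?(gt_eqF kR) ?implybT// powRr1 ?(ltW kR)// div1r.
    rewrite powRM ?invr_ge0 ?(ltW kR) ?(ltW nR)//.
    rewrite -[in RHS](powR_inv1 (ltW nR)) -powRrM mulN1r powRN.
    have := powR_gt0 k%:R^-1 nR; set a := _ `^ _ => a0.
    rewrite nE; field; rewrite !gt_eqF// addr_gt0//.
  exact: bowl_asymp_large k0 uphi phid vs.
Qed.
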